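(* Let $X$ be a Banach space and let $\lambda\geqslant 1$. Then the following assertions are equivalent: (i) $X$ is complemented in $X^{**}$ by a projection of norm at most $\lambda$, that is, there exists a bounded linear projection from $X^{**}$ onto the canonical copy $\kappa_X(X)$ of $X$ in $X^{**}$ of norm at most $\lambda$; (ii) for every amenable semigroup $S$ there exists an $X$-valued invariant $\lambda$-mean on $S$; (iii) when $G$ is a free Abelian group of rank $|X^{**}|$ (the cardinality of $X^{**}$), there exists an $X$-valued invariant $\lambda$-mean on $G$; (iv) there exists an $X$-valued invariant $\lambda$-mean on the additive group of $X^{**}$.
   Context: The canonical embedding $\kappa_X\colon X\to X^{**}$ is given by $\langle \kappa_X x, f\rangle = \langle f,x\rangle$ ($x\in X$, $f\in X^*$). For a semigroup $(S,\cdot)$, $\ell_\infty(S,X)$ denotes the Banach space of all bounded functions $S\to X$ with the supremum norm. For $x\in X$, $x\mathds{1}_S$ is the function constantly equal to $x$ on $S$. For $f\in\ell_\infty(S,X)$ and $s\in S$ put ${}_sf(t)=f(s\cdot t)$ and $f_s(t)=f(t\cdot s)$ ($t\in S$). For $\lambda\geqslant 1$, an $X$-valued invariant $\lambda$-mean on $S$ is a bounded linear operator $M\colon \ell_\infty(S,X)\to X$ of norm at most $\lambda$ such that for all $x\in X$, $s\in S$ and $f\in\ell_\infty(S,X)$: $M(x\mathds{1}_S)=x$ and $M(f)=M({}_sf)=M(f_s)$. Groups are regarded as semigroups. A semigroup is amenable if it admits an invariant $1$-mean with values in the scalar field (regarded as a one-dimensional Banach space). A free Abelian group of rank $\alpha$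 ($\alpha$ a cardinal) is a group isomorphic to $\mathbb{Z}^{(\alpha)}$, the direct sum of $\alpha$-many copies of $\mathbb{Z}$. *)

(* Defs.v *)
From HB Require Import structures.
From mathcomp Require Import all_boot all_order all_algebra.
From mathcomp Require Import complex.
From mathcomp Require Import all_classical reals topology normedtype.
From mathcomp.multinomials Require freeg.

Set Implicit Arguments.
Unset Strict Implicit.
Unset Printing Implicit Defensive.

Import Order.TTheory GRing.Theory Num.Theory.
Import numFieldNormedType.Exports.
Import freeg.FreegDefs.Exports freeg.FreegZmodType.Exports.

Local Open Scope classical_set_scope.
Local Open Scope ring_scope.

Variant scalar_kind := RealScalars | ComplexScalars.

(* The scalar field of a Banach space: either R or R[i].  Norms take values in
   the scalar field; in R[i] the order is partial, [0 <= z] (or [1 <= z])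
   entails that [z] is real, and it extends the order of R. *)
Definition scalars (R : realType) (k : scalar_kind) : numFieldType :=
  match k with
  | RealScalars => R
  | ComplexScalars => R[i]
  end.

Lemma real_supremums (R : realType) (E : set R) :
  E !=set0 -> has_ubound E -> supremums E !=set0.
Proof.
move=> E0 Eb; exists (sup E); split; first exact: sup_upper_bound.
by move=> c Ec; apply: ge_sup.
Qed.

Lemma complex_supremums (R : realType) (E : set R[i]) :
  E !=set0 -> (forall x, E x -> 0 <= x) -> has_ubound E -> supremums E !=set0.
Proof.
move=> [e Ee] E0 [b Eb].
have ReE x : E x -> x = (complex.Re x)%:C%C.
  by move=> /E0; rewrite lecE /= => /andP[/eqP]; case: x => a c /= ->.
have [||c [Fc cF]] := @real_supremums R [set complex.Re x | x in E].
- by exists (complex.Re e), e.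
- exists (complex.Re b) => _ [x Ex <-].
  by have := Eb _ Ex; rewrite lecE => /andP[].
exists c%:C%C; split=> [x Ex|d Ed].
  by rewrite (ReE _ Ex) lecR; apply: Fc; exists x.
have := Ed _ Ee; rewrite (ReE _ Ee) lecE /= => /andP[/eqP d0 _].
rewrite lecE /= d0 eqxx /=; apply: cF => _ [x Ex <-].
by have := Ed _ Ex; rewrite lecE => /andP[].
Qed.

Lemma scalars_supremums (R : realType) (k : scalar_kind)
    (E : set (scalars R k)) :
  E !=set0 -> (forall x, E x -> 0 <= x) -> has_ubound E -> supremums E !=set0.
Proof.
by case: k E => E E0 Ege0; [exact: real_supremums|exact: complex_supremums].
Qed.

Lemma scalars_supremumP (R : realType) (k : scalar_kind)
    (E : set (scalars R k)) :
  E !=set0 -> (forall x, E x -> 0 <= x) -> has_ubound E ->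
  supremums E (supremum 0 E).
Proof.
move=> E0 Ege0 Eub; have [c Ec] := scalars_supremums E0 Ege0 Eub.
rewrite /supremum ifF; last by apply/negbTE/set0P.
by case: xgetP => // /(_ c).
Qed.

Section BoundedOperators.
Variables (R : realType) (k : scalar_kind).
Local Notation K := (scalars R k).
Variables X Y : normedModType K.

Definition bounded_linear : {pred X -> Y} :=
  fun f => `[< linear f /\ exists C : K, forall x, `|f x| <= C * `|x| >].

Lemma bounded_linear_closed : submod_closed bounded_linear.
Proof.
split.
  apply/asboolP; split; first by move=> a u v; rewrite scaler0 addr0.
  by exists 0 => x; rewrite mul0r normr0.
move=> a f g /asboolP[fl [C fC]] /asboolP[gl [D gD]]; apply/asboolP; split.
  move=> b u v; rewrite -![(a *: f + g) _]/(a *: f _ + g _) fl gl.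
  rewrite !scalerDr !scalerA (mulrC a b) -!addrA; congr (_ + _).
  by rewrite addrCA.
exists (`|a| * C + D) => x; rewrite -[(a *: f + g) x]/(a *: f x + g x).
rewrite mulrDl (le_trans (ler_normD _ _))// lerD ?gD// normrZ -mulrA.
by rewrite ler_wpM2l.
Qed.

HB.instance Definition _ := GRing.isSubmodClosed.Build K (X -> Y)
  bounded_linear bounded_linear_closed.

Record bop := Bop {
  bop_fun :> X -> Y;
  _ : bop_fun \in bounded_linear }.

HB.instance Definition _ := [isSub for bop_fun].
HB.instance Definition _ := [Choice of bop by <:].
HB.instance Definition _ := [SubChoice_isSubLmodule of bop by <:].

Lemma bop_linear (T : bop) : linear T.
Proof. by case: T => f /= /asboolP[]. Qed.

HB.instance Definition _ (T : bop) :=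
  GRing.isLinear.Build K X Y *:%R T (bop_linear T).

Definition opnorm (T : bop) : K :=
  supremum 0 [set `|T x| | x in [set x | `|x| <= 1]].

Lemma opnormP (T : bop) :
  supremums [set `|T x| | x in [set x | `|x| <= 1]] (opnorm T).
Proof.
apply: scalars_supremumP.
- by exists `|T 0|, 0 => //=; rewrite normr0 ler01.
- by move=> _ [x _ <-].
- case: (T) => f /= /asboolP[_ [C fC]]; exists `|C| => _ [x /= x1 <-].
  have fC0 : 0 <= C * `|x| by apply: le_trans (fC x).
  rewrite (le_trans (fC x))// -(ger0_norm fC0) normrM normr_id.
  by rewrite ler_piMr.
Qed.

Lemma ler_opnorm1 (T : bop) (x : X) : `|x| <= 1 -> `|T x| <= opnorm T.
Proof.
by move=> x1; case: (opnormP T) => + _; apply; exists x.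
Qed.

Lemma opnorm_ge0 (T : bop) : 0 <= opnorm T.
Proof. by rewrite (le_trans _ (@ler_opnorm1 T 0 _))// normr0. Qed.

Lemma ler_opnorm (T : bop) (x : X) : `|T x| <= opnorm T * `|x|.
Proof.
have [->|x0] := eqVneq x 0; first by rewrite linear0 !normr0 mulr0.
have nx : 0 < `|x| by rewrite normr_gt0.
rewrite -ler_pdivrMr// mulrC.
suff -> : `|x|^-1 * `|T x| = `|T (`|x|^-1 *: x)|.
  by apply: ler_opnorm1; rewrite normfZV.
by rewrite linearZ normrZ ger0_norm// invr_ge0.
Qed.

Lemma opnorm_le (T : bop) (C : K) :
  0 <= C -> (forall x, `|T x| <= C * `|x|) -> opnorm T <= C.
Proof.
move=> C0 TC; case: (opnormP T) => _; apply=> _ [x /= x1 <-].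
by rewrite (le_trans (TC x))// ler_piMr.
Qed.

Lemma opnormD (S T : bop) : opnorm (S + T) <= opnorm S + opnorm T.
Proof.
apply: opnorm_le => [|x]; first by rewrite addr_ge0// opnorm_ge0.
rewrite mulrDl (le_trans (ler_normD (S x) (T x)))// lerD// ler_opnorm//.
Qed.

Lemma opnormZ (a : K) (T : bop) : opnorm (a *: T) = `|a| * opnorm T.
Proof.
have le_opnormZ (b : K) (S : bop) : opnorm (b *: S) <= `|b| * opnorm S.
  apply: opnorm_le => [|x]; first by rewrite mulr_ge0// opnorm_ge0.
  by rewrite -mulrA [leLHS](normrZ b (S x)) ler_wpM2l// ler_opnorm.
have [->|a0] := eqVneq a 0.
  apply/eqP; rewrite eq_le normr0 mul0r opnorm_ge0 andbT.
  by rewrite (le_trans (le_opnormZ _ _))// normr0 mul0r.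
apply/eqP; rewrite eq_le le_opnormZ /= -ler_pdivlMl ?normr_gt0//.
rewrite -normfV (le_trans _ (le_opnormZ _ _))//.
by rewrite scalerA mulVf// scale1r.
Qed.

Lemma opnorm_eq0 (T : bop) : opnorm T = 0 -> T = 0.
Proof.
move=> T0; apply/val_inj/funext => x /=; apply/eqP.
by rewrite -normr_le0 (le_trans (ler_opnorm T x))// T0 mul0r.
Qed.

HB.instance Definition _ :=
  Lmodule_isNormed.Build K bop opnormD opnormZ opnorm_eq0.

End BoundedOperators.

Section BoundedFunctions.
Variables (R : realType) (k : scalar_kind).
Local Notation K := (scalars R k).
Variables (S : Type) (X : normedModType K).

Definition bounded_function : {pred S -> X} :=
  fun f => `[< exists C : K, forall s, `|f s| <= C >].

Lemma bounded_function_closed : submod_closed bounded_function.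
Proof.
split; first by apply/asboolP; exists 0 => s; rewrite normr0.
move=> a f g /asboolP[C fC] /asboolP[D gD]; apply/asboolP.
exists (`|a| * C + D) => s; rewrite -[(a *: f + g) s]/(a *: f s + g s).
by rewrite (le_trans (ler_normD _ _))// lerD// normrZ ler_wpM2l.
Qed.

HB.instance Definition _ := GRing.isSubmodClosed.Build K (S -> X)
  bounded_function bounded_function_closed.

Record linfty := Linfty {
  linfty_fun :> S -> X;
  _ : linfty_fun \in bounded_function }.

HB.instance Definition _ := [isSub for linfty_fun].
HB.instance Definition _ := [Choice of linfty by <:].
HB.instance Definition _ := [SubChoice_isSubLmodule of linfty by <:].

(* The default value [0] of [supremum] is used only when [S] is empty. *)
Definition supnorm (f : linfty) : K := supremum 0 (range (fun s => `|f s|)).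

Lemma supnormP (f : linfty) :
  S -> supremums (range (fun s => `|f s|)) (supnorm f).
Proof.
move=> s0; apply: scalars_supremumP.
- by exists `|f s0|, s0.
- by move=> _ [s _ <-].
- by case: (f) => g /= /asboolP[C gC]; exists C => _ [s _ <-].
Qed.

Lemma ler_supnorm (f : linfty) (s : S) : `|f s| <= supnorm f.
Proof. by case: (supnormP f s) => + _; apply; exists s. Qed.

Lemma supnorm_ge0 (f : linfty) : 0 <= supnorm f.
Proof.
have [[s]|S0] := pselect (inhabited S).
  exact: le_trans (ler_supnorm f s).
rewrite /supnorm (_ : [set _ | _ in _] = set0) ?supremum0//.
by rewrite -subset0 => x [s _ _]; case: S0; exists.
Qed.

Lemma supnorm_le (f : linfty) (C : K) :
  0 <= C -> (forall s, `|f s| <= C) -> supnorm f <= C.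
Proof.
move=> C0 fC; rewrite /supnorm /supremum; case: ifPn => // _.
by case: xgetP => // y _ [_]; apply=> _ [s _ <-].
Qed.

Lemma supnormD (f g : linfty) : supnorm (f + g) <= supnorm f + supnorm g.
Proof.
apply: supnorm_le => [|s]; first by rewrite addr_ge0// supnorm_ge0.
by rewrite (le_trans (ler_normD (f s) (g s)))// lerD// ler_supnorm.
Qed.

Lemma supnormZ (a : K) (f : linfty) : supnorm (a *: f) = `|a| * supnorm f.
Proof.
have le_supnormZ (b : K) (g : linfty) : supnorm (b *: g) <= `|b| * supnorm g.
  apply: supnorm_le => [|s]; first by rewrite mulr_ge0// supnorm_ge0.
  by rewrite [leLHS](normrZ b (g s)) ler_wpM2l// ler_supnorm.
have [->|a0] := eqVneq a 0.
  apply/eqP; rewrite eq_le normr0 mul0r supnorm_ge0 andbT.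
  by rewrite (le_trans (le_supnormZ _ _))// normr0 mul0r.
apply/eqP; rewrite eq_le le_supnormZ /= -ler_pdivlMl ?normr_gt0//.
rewrite -normfV (le_trans _ (le_supnormZ _ _))//.
by rewrite scalerA mulVf// scale1r.
Qed.

Lemma supnorm_eq0 (f : linfty) : supnorm f = 0 -> f = 0.
Proof.
move=> f0; apply/val_inj/funext => s /=; apply/eqP.
by rewrite -normr_le0 (le_trans (ler_supnorm f s))// f0.
Qed.

HB.instance Definition _ :=
  Lmodule_isNormed.Build K linfty supnormD supnormZ supnorm_eq0.

Lemma linfty_cst_subproof (x : X) : (fun=> x) \in bounded_function.
Proof. by apply/asboolP; exists `|x| => s. Qed.

Definition linfty_cst (x : X) : linfty := Linfty (linfty_cst_subproof x).

Lemma linfty_comp_subproof (f : linfty) (h : S -> S) :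
  f \o h \in bounded_function.
Proof.
by case: f => f /= /asboolP[C fC]; apply/asboolP; exists C => s; exact: fC.
Qed.

Definition linfty_comp (f : linfty) (h : S -> S) : linfty :=
  Linfty (linfty_comp_subproof f h).

End BoundedFunctions.

Section Bidual.
Variables (R : realType) (k : scalar_kind).
Local Notation K := (scalars R k).

Definition dual (X : normedModType K) : normedModType K := bop X K^o.

Definition bidual (X : normedModType K) : normedModType K := dual (dual X).

Variable X : normedModType K.

Lemma kappa_subproof (x : X) :
  (fun f : dual X => (f : bop X K^o) x) \in
    @bounded_linear R k (dual X) K^o.
Proof.
apply/asboolP; split=> //; exists `|x| => f.
by rewrite mulrC ler_opnorm.
Qed.

Definition kappa (x : X) : bidual X := Bop (kappa_subproof x).

Definition complemented_in_bidual (lambda : K) : Prop :=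
  exists P : bop (bidual X) (bidual X),
    [/\ forall phi, P (P phi) = P phi,
        range P = range kappa
      & `|P| <= lambda].

End Bidual.

Section InvariantMeans.
Variables (R : realType) (k : scalar_kind).
Local Notation K := (scalars R k).
Local Open Scope group_scope.

Definition ltranslate (S : semigroupType) (X : normedModType K) (s : S)
  (f : linfty S X) : linfty S X := linfty_comp f (fun t => s * t).

Definition rtranslate (S : semigroupType) (X : normedModType K) (s : S)
  (f : linfty S X) : linfty S X := linfty_comp f (fun t => t * s).

Definition invariant_mean (S : semigroupType) (X : normedModType K)
    (lambda : K) (M : bop (linfty S X) X) : Prop :=
  [/\ (`|M| <= lambda)%R,
      forall x, M (linfty_cst S x) = x
    & forall s f, M f = M (ltranslate s f) /\ M f = M (rtranslate s f)].

Definition has_invariant_mean (S : semigroupType) (X : normedModType K)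
  (lambda : K) : Prop := exists M, @invariant_mean S X lambda M.

End InvariantMeans.

Definition amenable (R : realType) (k : scalar_kind) (S : semigroupType) :=
  has_invariant_mean S (scalars R k)^o 1.

(* [{freeg I}] is the direct sum of copies of the integers indexed by [I]; the
   cardinal prescribing the rank is represented by the index type [I]. *)
Definition free_abelian_group_of_rank (I : choiceType) (G : groupType) : Prop :=
  exists phi : {multiplicative Algebra.to_multiplicative {freeg I} -> G},
    bijective phi.

(* Main.v *)
Require Import Defs.
From HB Require Import structures.
From mathcomp Require Import all_boot all_order all_algebra.
From mathcomp Require Import complex.
From mathcomp Require Import all_classical reals topology normedtype.
From mathcomp.multinomials Require Import freeg.

Set Implicit Arguments.
Unset Strict Implicit.
Unset Printing Implicit Defensive.

Import Order.TTheory GRing.Theory Num.Theory.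
Import numFieldNormedType.Exports.

Local Open Scope classical_set_scope.
Local Open Scope ring_scope.

(* (i) => (ii): if [m] is a scalar invariant mean, then [f |-> (g |-> m (g o f))]
   takes values in [X^**], and the projection brings it back to [X].

   (ii) => (iii) => (iv): commutative groups are amenable, and means pass to
   quotients, such as the additive group of [X^**] of the free abelian group on
   its points.

   (iv) => (i): let [M] be a mean on [X^**].  Functions supported on a set having
   arbitrarily many disjoint translates are annihilated by [M], so that any
   coordinate of a generic [g] over [rat] is non-zero, and large.  Hence finite
   sets [s g] can be read off the coordinates of [g] in such a way that each [phi]
   lies in [s g] for almost every [g].  By Helly's theorem (a weak form of local
   reflexivity) there is a map [T g : X^** -> X] that on [s g] is linear, bounded
   by [`|phi|] and inverse to [kappa], up to an error vanishing as [g] becomes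
   generic.  Then [phi |-> M (g |-> T g phi)] is the projection. *)

(** * Linear functionals dominated by a seminorm *)

Definition subspace (F : nzRingType) (V : lmodType F) (W : set V) :=
  W 0 /\ forall a u v, W u -> W v -> W (a *: u + v).

(** Zorn's lemma in the form shared by the Hahn-Banach theorem, where [A] is the region below a
    graph, and by the complement of a kernel in [free_module_section]. Maximality is tested one line
    at a time. *)
Lemma maximal_subspace (F : nzRingType) (V : lmodType F) (A W0 : set V) :
  subspace W0 -> W0 `<=` A ->
  exists W, [/\ subspace W, W0 `<=` W, W `<=` A
    & forall x, (forall a w, W w -> A (a *: x + w)) -> W x].
Proof.
move=> W0s W0A.
(* [W0] is joined to [W] instead of being required inside it, so that the union of the empty chain
   is good as well. *)
pose good W := subspace (W `|` W0) /\ W `<=` A.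
have [C CP Ctot|W [[Ws WA] Wmax]] := @Zorn_bigcup V good.
  split; last by move=> x [Y CY Yx]; exact: (CP _ CY).2.
  split=> [|a u v]; first by right; case: W0s.
  have step Y : C Y -> (Y `|` W0) u -> (Y `|` W0) v ->
      (\bigcup_(X in C) X `|` W0) (a *: u + v).
    move=> CY Yu Yv; have [[_ Ys] _] := CP _ CY.
    by have [Yx|W0x] := Ys a u v Yu Yv; [left; exists Y|right].
  move=> [[Y CY Yu]|W0u] [[Z CZ Zv]|W0v].
  - have [YZ|ZY] := Ctot _ _ CY CZ.
      by apply: (step Z) => //; left => //; exact: YZ.
    by apply: (step Y) => //; left => //; exact: ZY.
  - by apply: (step Y) => //; [left|right].
  - by apply: (step Z) => //; [right|left].
  - by right; exact: W0s.2.
exists (W `|` W0); split=> //; first by move=> x [/WA|/W0A].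
move=> x xA; apply: contrapT => xW.
pose W' := [set a *: x + w | a in [set: F] & w in W `|` W0].
have WW' y : (W `|` W0) y -> W' y.
  by exists 0 => //; exists y => //; rewrite scale0r add0r.
have W'W0 : W' `|` W0 = W'.
  by rewrite eqEsubset; split=> [y [//|W0y]|y W'y]; [apply: WW'; right|left].
apply: (Wmax W'); first split=> [y Wy|W'W].
- by apply: WW'; left.
- apply: xW; left; apply: W'W; exists 1 => //; exists 0; first exact: Ws.1.
  by rewrite scale1r addr0.
- split; last by move=> _ [a _ [w Ww <-]]; exact: xA.
  rewrite W'W0; split; first by apply: WW'; exact: Ws.1.
  move=> a _ _ [b _ [u Wu <-]] [c _ [v Wv <-]].
  exists (a * b + c) => //; exists (a *: u + v); first exact: Ws.2.
  by rewrite scalerDr scalerA scalerDl addrACA.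
Qed.

Lemma subspace_line (F : nzRingType) (V : lmodType F) (v : V) :
  subspace (range (fun a : F => a *: v)).
Proof.
split; first by exists 0 => //; rewrite scale0r.
by move=> a _ _ [b _ <-] [c _ <-]; exists (a * b + c) => //;
   rewrite scalerDl scalerA.
Qed.

Lemma subspace_scale (F : nzRingType) (V : lmodType F) (W : set V) a u :
  subspace W -> W u -> W (a *: u).
Proof. by move=> [W0 Ws] Wu; rewrite -[_ *: _]addr0; exact: Ws. Qed.

(** A maximal subspace of [V * R] below the graph of [p] and containing [(v0, p v0)] is the graph of
    the functional: it is single-valued because [p 0 = 0], and total by the usual extension by one
    vector. *)
Lemma hahn_banach_sublinear (R : realType) (V : lmodType R) (p : V -> R) v0 :
  (forall u v, p (u + v) <= p u + p v) ->
  (forall a u, 0 <= a -> p (a *: u) = a * p u) ->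
  exists g : V -> R, [/\ linear g, forall u, g u <= p u & g v0 = p v0].
Proof.
move=> pD pZ.
have p0 : p 0 = 0 by rewrite -(scale0r 0) pZ// mul0r.
have pN u : - p (- u) <= p u.
  by rewrite lerNl -subr_ge0 opprK -[X in X <= _]p0 -(addNr u) pD.
pose A : set (V * R^o)%type := [set x | x.2 <= p x.1].
have [||G [Gs G0 GA Gmax]] := @maximal_subspace R (V * R^o)%type A
    (range (fun a : R => a *: (v0, p v0))).
- exact: subspace_line.
- move=> _ [a _ <-]; rewrite /A /=.
  have [a0|/ltW a0] := leP 0 a; first by rewrite pZ.
  have -> : a *: v0 = - ((- a) *: v0) by rewrite scaleNr opprK.
  rewrite (le_trans _ (pN _)) ?opprK// pZ ?oppr_ge0//.
  by rewrite mulNr opprK /=.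
have Gfun v r s : G (v, r) -> G (v, s) -> r <= s.
  move=> Gr Gs'; rewrite -subr_le0.
  suff /GA : G ((0 : V), r - s) by rewrite /A /= p0.
  have := Gs.2 (-1) _ _ Gs' Gr.
  rewrite (_ : _ + _ = ((0 : V), r - s))//.
  by apply/pair_equal_spec; split => /=;
    rewrite ?scaleN1r ?addNr//  addrC.
have Gtot w : exists r, G (w, r).
  (* The value at [w] has to lie above every [r - p (u - w)] and below every [p (u + w) - r] with
     [(u, r)] in [G]; the supremum of the former does. *)
  pose E := [set x.2 - p (x.1 - w) | x in G].
  have Eub x : G x -> ubound E (p (x.1 + w) - x.2).
    case: x => u r Gur _ [[v s] Gvs <-] /=.
    rewrite lerBlDr addrAC lerBrDr.
    have := GA _ (Gs.2 1 _ _ Gvs Gur).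
    rewrite /A /= !scale1r => /le_trans; apply.
    have -> : v + u = (u + w) + (v - w) by rewrite addrACA subrr addr0 addrC.
    exact: pD.
  have supE : has_sup E.
    split; first by exists (0 - p (0 - w)), (0, 0) => //; exact: Gs.1.
    by exists (p (0 + w) - 0); exact: (Eub (0, 0) Gs.1).
  exists (sup E); apply: Gmax => a [u r] Gur; rewrite /A /=.
  have [->|a0] := eqVneq a 0.
    by rewrite !scale0r !add0r; exact: (GA (u, r)).
  pose x : V * R^o := `|a|^-1 *: (u, r).
  have Gx : G x by exact: subspace_scale.
  have na : 0 < `|a| by rewrite normr_gt0.
  have -> : a *: w + u = `|a| *: ((a / `|a|) *: w + x.1).
    rewrite scalerDr [x.1]/(`|a|^-1 *: u) !scalerA mulrCA mulfV ?gt_eqF//.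
    by rewrite mulr1 scale1r.
  have -> : a *: (sup E : R^o) + r = `|a| * ((a / `|a|) * sup E + x.2).
    rewrite mulrDr [x.2]/(`|a|^-1 * r) !mulrA mulfV ?gt_eqF// mul1r.
    by rewrite (mulrC `|a|) -(mulrA a) mulfV ?gt_eqF// mulr1.
  rewrite pZ// ler_pM2l//.
  have [ap|an] := ltP 0 a.
    rewrite gtr0_norm// mulfV// mul1r scale1r -lerBrDr.
    by apply: (ge_sup supE.1); rewrite [w + _]addrC; exact: Eub.
  rewrite ler0_norm// invrN mulrN mulfV// mulN1r scaleN1r.
  rewrite [_ + x.2]addrC [_ + x.1]addrC lerBlDl -lerBlDr.
  by apply: ub_le_sup; [exact: supE.2|exists x].
have [g gG] := choice Gtot.
have gE v r : G (v, r) -> g v = r.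
  by move=> Gr; apply/eqP; rewrite eq_le !(Gfun v).
exists g; split.
- by move=> a u v; apply: gE; exact: (Gs.2 a _ _ (gG u) (gG v)).
- by move=> u; exact: (GA _ (gG u)).
- by apply: gE; apply: G0; exists 1 => //; rewrite scale1r.
Qed.

(** A new name for [V], so that its structure over [A] does not compete with that over [B]. It
    serves for [R] inside [R[i]] and for [rat] inside the scalars. *)
Definition restrict_scalars (A B : nzRingType) (f : {rmorphism A -> B})
  (V : lmodType B) : Type := V.

Section RestrictScalars.
Variables (A B : nzRingType) (f : {rmorphism A -> B}) (V : lmodType B).
Local Notation W := (restrict_scalars f V).

HB.instance Definition _ := GRing.Zmodule.on W.

Definition restricted_scale (a : A) (v : W) : W := f a *: (v : V).

Lemma restricted_scaleA a b v :
  restricted_scale a (restricted_scale b v) = restricted_scale (a * b) v.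
Proof. by rewrite /restricted_scale scalerA rmorphM. Qed.

Lemma restricted_scale1 : left_id 1 restricted_scale.
Proof. by move=> v; rewrite /restricted_scale rmorph1 scale1r. Qed.

Lemma restricted_scaleDr : right_distributive restricted_scale +%R.
Proof. by move=> a u v; rewrite /restricted_scale scalerDr. Qed.

Lemma restricted_scaleDl v : {morph restricted_scale^~ v : a b / a + b}.
Proof. by move=> a b; rewrite /restricted_scale rmorphD scalerDl. Qed.

HB.instance Definition _ := GRing.Zmodule_isLmodule.Build A W
  restricted_scaleA restricted_scale1 restricted_scaleDr restricted_scaleDl.

End RestrictScalars.

Section SeminormFunctional.
Variable R : realType.

Lemma seminorm_ge0 (K : numFieldType) (V : lmodType K) (q : V -> K) u :
  (forall u v, q (u + v) <= q u + q v) ->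
  (forall a u, q (a *: u) = `|a| * q u) -> 0 <= q u.
Proof.
move=> qD qZ; have q0 : q 0 = 0 by rewrite -(scale0r 0) qZ normr0 mul0r.
have := qD u (- u); rewrite subrr q0 -scaleN1r qZ normrN1 mul1r.
by rewrite -mulr2n pmulrn_lge0.
Qed.

Lemma real_seminorm_functional (V : lmodType R) (q : V -> R) v0 :
  (forall u v, q (u + v) <= q u + q v) ->
  (forall a u, q (a *: u) = `|a| * q u) ->
  exists g : V -> R^o, [/\ linear g, forall u, `|g u| <= q u & g v0 = q v0].
Proof.
move=> qD qZ.
have qZ' a u : 0 <= a -> q (a *: u) = a * q u by move=> a0; rewrite qZ ger0_norm.
have [g [glin gq gv0]] := hahn_banach_sublinear v0 qD qZ'.
exists g; split=> // u; rewrite ler_norml gq andbT lerNl.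
have g0 : g 0 = 0.
  by have := glin (-1) 0 0; rewrite scaler0 addr0 scaleN1r addNr.
have -> : - g u = g (- u) by rewrite -[- u]addr0 -scaleN1r glin g0 scaleN1r addr0.
by rewrite (le_trans (gq _))// -scaleN1r qZ normrN1 mul1r.
Qed.

(* The functional [g] is recovered from its real part [r], found by the real
   theorem, as [g u = r u - i r (i u)]. *)
Lemma complex_seminorm_functional (V : lmodType R[i]) (q : V -> R[i]) v0 :
  (forall u v, q (u + v) <= q u + q v) ->
  (forall a u, q (a *: u) = `|a| * q u) ->
  exists g : V -> R[i]^o, [/\ linear g, forall u, `|g u| <= q u & g v0 = q v0].
Proof.
move=> qD qZ.
have q_ge0 u : 0 <= q u by exact: seminorm_ge0.
pose VR := restrict_scalars (real_complex R) V.
pose p (u : VR) : R := complex.Re (q u).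
have qE u : q u = (p u)%:C%C by rewrite /p RRe_real// ger0_real.
have pD (u v : VR) : p (u + v) <= p u + p v.
  by have := qD u v; rewrite !qE -rmorphD lecR.
have pZ (a : R) (u : VR) : 0 <= a -> p (a *: u) = a * p u.
  move=> a0; rewrite /p qZ qE ger0_norm ?lecR//.
  by rewrite -rmorphM.
have [g [glin gp gv0]] := @hahn_banach_sublinear R (VR) p v0 pD pZ.
have gD u v : g (u + v) = g u + g v.
  by have := glin 1 u v; rewrite !scale1r.
have gZ (a : R) (u : V) : g (a%:C%C *: u) = a * g u.
  have g0 : g 0 = 0 by apply: (addrI (g 0)); rewrite -gD !addr0.
  by have := glin a u 0; rewrite g0 !addr0.
pose h (u : V) : R[i]^o := (g u +i* - g ('i%C *: u))%C.
have hZi u : h ('i%C *: u) = 'i%C * h u.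
  rewrite /h scalerA -expr2 sqr_i scaleN1r.
  have -> : g (- u) = - g u by rewrite -scaleN1r -(rmorphN1 (real_complex R)) gZ mulN1r.
  by simpc.
have hD u v : h (u + v) = h u + h v.
  by rewrite /h scalerDr !gD opprD.
have hlin : linear h.
  move=> a u v; rewrite hD; congr (_ + _).
  have hR (b : R) w : h (b%:C%C *: w) = b%:C%C * h w.
    by rewrite /h scalerA mulrC -scalerA !gZ; simpc.
  rewrite {1}(complexE a) scalerDl hD hR -scalerA hZi hR.
  by rewrite mulrA -mulrDl -complexE.
have hq u : `|h u| <= q u.
  have [->|hu0] := eqVneq (h u) 0; first by rewrite normr0.
  (* The rotation making [h (a *: u)] real and nonnegative, hence equal to its real part, which [p]
     bounds. *)
  pose a : R[i] := `|h u| / h u.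
  have na : `|a| = 1 by rewrite normrM normfV normr_id mulfV// normr_eq0.
  have hau : h (a *: u) = `|h u|.
    have h0 : h 0 = 0 by apply: (addrI (h 0)); rewrite -hD !addr0.
    have := hlin a u 0; rewrite !addr0 h0 addr0 => ->.
    by rewrite -[LHS]/(a * h u) /a divfK.
  rewrite -hau -[q u]mul1r -na -qZ qE lecE.
  have : h (a *: u) \is Num.real by rewrite hau normr_real.
  rewrite complex_real /= => /eqP ->. rewrite eqxx /=; exact: gp.
exists h; split=> //.
have Re_h : complex.Re (h v0) = p v0 by exact: gv0.
(* The real part of [h v0] already exhausts the bound [q v0] on its modulus, so the imaginary part
   vanishes. *)
have : `|h v0| ^+ 2 <= q v0 ^+ 2 by rewrite lerXn2r ?nnegrE.
rewrite -add_Re2_Im2 Re_h qE -rmorphXn lecR gerDl => Im_h.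
rewrite (complexE (h v0)) Re_h.
suff -> : complex.Im (h v0) = 0 by rewrite mulr0 addr0.
by apply/eqP; rewrite -sqrf_eq0 eq_le Im_h sqr_ge0.
Qed.

Lemma seminorm_functional (k : scalar_kind) (V : lmodType (scalars R k))
    (q : V -> scalars R k) v0 :
  (forall u v, q (u + v) <= q u + q v) ->
  (forall a u, q (a *: u) = `|a| * q u) ->
  exists g : V -> (scalars R k)^o,
    [/\ linear g, forall u, `|g u| <= q u & g v0 = q v0].
Proof.
case: k V q v0; [exact: real_seminorm_functional|].
exact: complex_seminorm_functional.
Qed.

(** The infimum is the supremum of the nonnegative lower bounds. Any other lower bound is comparable
    with a real number, hence real, hence negative. *)
Lemma scalars_infimum (k : scalar_kind) (S : set (scalars R k)) :
  S !=set0 -> (forall t, S t -> 0 <= t) ->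
  exists m, [/\ 0 <= m, lbound S m & forall s, lbound S s -> s <= m].
Proof.
move=> [t0 St0] S0.
have [|s []//||m [mub mlub]] := @scalars_supremums R k [set s | 0 <= s /\ lbound S s].
- by exists 0; split.
- by exists t0 => s [_]; exact.
have m0 : 0 <= m by apply: mub; split.
exists m; split=> // [t St|s Ss]; first by apply: mlub => s [_]; exact.
have sr : s \is Num.real by rewrite (ler_real (Ss _ St0)) ger0_real ?S0.
have [s0|/ltW s0] := real_leP (real0 _) sr; first by apply: mub; split.
exact: le_trans m0.
Qed.

(* The functional is bounded by the seminorm [v |-> inf (S v)], which it
   attains at [v0]. *)
Lemma gauge_functional (k : scalar_kind) (V : lmodType (scalars R k))
    (S : V -> set (scalars R k)) v0 :
  (forall v, S v !=set0) -> (forall v t, S v t -> 0 <= t) ->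
  (forall u v s t, S u s -> S v t -> S (u + v) (s + t)) ->
  (forall a v t, S v t -> S (a *: v) (`|a| * t)) ->
  exists g : V -> (scalars R k)^o,
    [/\ linear g, forall v t, S v t -> `|g v| <= t
      & forall s, lbound (S v0) s -> s <= g v0].
Proof.
move=> Sn0 S_ge0 SD SZ.
have /choice[q qP] v := scalars_infimum (Sn0 v) (@S_ge0 v).
have qD u v : q (u + v) <= q u + q v.
  have [_ _ qu] := qP u; have [_ _ qv] := qP v; have [_ quv _] := qP (u + v).
  rewrite -lerBlDr; apply: qu => s Ss.
  rewrite lerBlDr -lerBlDl; apply: qv => t St.
  by rewrite lerBlDl; apply: quv; exact: SD.
have qZ_le a u : q (a *: u) <= `|a| * q u.
  have [_ _ qu] := qP u; have [_ qau _] := qP (a *: u).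
  have [a0|a0] := eqVneq a 0.
    have [t St] := Sn0 u; move: qau (SZ a u t St).
    by rewrite a0 normr0 !mul0r; exact.
  have na : 0 < `|a| by rewrite normr_gt0.
  rewrite -ler_pdivrMl//; apply: qu => t St.
  by rewrite ler_pdivrMl//; apply: qau; exact: SZ.
have qZ a u : q (a *: u) = `|a| * q u.
  have [a0|a0] := eqVneq a 0.
    apply/eqP; rewrite eq_le qZ_le /= a0 normr0 mul0r.
    by have [] := qP (0 *: u).
  apply/eqP; rewrite eq_le qZ_le /= -ler_pdivlMl ?normr_gt0//.
  by rewrite -normfV (le_trans _ (qZ_le _ _))// scalerA mulVf// scale1r.
have [g [glin gq gv0]] := seminorm_functional v0 qD qZ.
exists g; split=> // [v t St|s Ss].
  by have [_ qv _] := qP v; exact: le_trans (gq v) (qv _ St).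
by rewrite gv0; have [_ _] := qP v0; exact.
Qed.

End SeminormFunctional.

(** * Bounded operators and the bidual *)

Section Operators.
Variables (R : realType) (k : scalar_kind).
Local Notation K := (scalars R k).

Lemma bounded_linearP (X Y : normedModType K) (f : X -> Y) C :
  linear f -> (forall x, `|f x| <= C * `|x|) -> f \in @bounded_linear R k X Y.
Proof. by move=> fl fC; apply/asboolP; split=> //; exists C. Qed.

Lemma exists_bop (X Y : normedModType K) (f : X -> Y) C :
  linear f -> 0 <= C -> (forall x, `|f x| <= C * `|x|) ->
  exists T : bop X Y, `|T| <= C /\ forall x, T x = f x.
Proof.
move=> fl C0 fC; exists (Bop (bounded_linearP fl fC)); split=> //.
exact: opnorm_le.
Qed.

Lemma ler_norm_bop (X Y : normedModType K) (T : bop X Y) x :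
  `|T x| <= `|T| * `|x|.
Proof. exact: ler_opnorm. Qed.

Lemma exists_linfty (S : Type) (X : normedModType K) (f : S -> X) C :
  (forall s, `|f s| <= C) -> exists F : linfty S X, forall s, F s = f s.
Proof.
move=> fC; have fb : f \in @bounded_function R k S X.
  by apply/asboolP; exists C.
by exists (Linfty fb).
Qed.

Lemma ler_norm_linfty (S : Type) (X : normedModType K) (f : linfty S X) s :
  `|f s| <= `|f|.
Proof. exact: ler_supnorm. Qed.

Lemma norm_linfty_le (S : Type) (X : normedModType K) (f : linfty S X) C :
  0 <= C -> (forall s, `|f s| <= C) -> `|f| <= C.
Proof. exact: supnorm_le. Qed.

Lemma linfty_ext (S : Type) (X : normedModType K) (f g : linfty S X) :
  (forall s, f s = g s) -> f = g.
Proof. by move=> fg; apply/val_inj/funext. Qed.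

Lemma bop_ext (X Y : normedModType K) (f g : bop X Y) :
  (forall x, f x = g x) -> f = g.
Proof. by move=> fg; apply/val_inj/funext. Qed.

Lemma bop_sumE (X Y : normedModType K) (I : Type) (s : seq I)
    (T : I -> bop X Y) x : (\sum_(i <- s) T i) x = \sum_(i <- s) T i x.
Proof. by elim/big_ind2 : _ => // f y g z <- <-. Qed.

Lemma norming_functional (X : normedModType K) (x : X) :
  exists f : bop X K^o, `|f| <= 1 /\ f x = `|x|.
Proof.
have [|||| g [glin gle gx]] :=
    @gauge_functional R k X (fun u => [set t | `|u| <= t]) x.
- by move=> v; exists `|v|; rewrite /=.
- by move=> v t; exact: le_trans.
- by move=> u v s t us vt; rewrite /= (le_trans (ler_normD _ _))// lerD.
- by move=> a v t vt; rewrite /= normrZ ler_wpM2l.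
have [|f [f1 fE]] := exists_bop glin ler01.
  by move=> u; rewrite mul1r gle /=.
exists f; split=> //; rewrite fE; apply/eqP; rewrite eq_le; apply/andP; split.
  have g0 : 0 <= g x by apply: (gx 0) => t /=; exact: le_trans.
  by rewrite -(ger0_norm g0) gle /=.
by apply: gx => t.
Qed.

Lemma le_norm_kappa (X : normedModType K) (x : X) : `|x| <= `|kappa x|.
Proof.
have [f [f1 fx]] := norming_functional x.
rewrite -(normr_id x) -fx -[f x]/(kappa x f).
by rewrite (le_trans (@ler_norm_bop (dual X) K^o (kappa x) f))// ler_piMr.
Qed.

Lemma norm_kappa (X : normedModType K) (x : X) : `|kappa x| = `|x|.
Proof.
apply/eqP; rewrite eq_le le_norm_kappa andbT.
apply: opnorm_le => // f; rewrite mulrC. exact: (@ler_norm_bop X K^o).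
Qed.

Lemma kappa_linear (X : normedModType K) : linear (@kappa R k X).
Proof. by move=> a u v; apply: bop_ext => f /=; exact: linearP. Qed.

Lemma kappa_inj (X : normedModType K) : injective (@kappa R k X).
Proof.
move=> u v uv; apply/eqP; rewrite -subr_eq0 -normr_le0.
have -> : u - v = (-1) *: v + u by rewrite scaleN1r addrC.
by rewrite -norm_kappa kappa_linear uv scaleN1r addNr normr0.
Qed.

End Operators.

(** * Helly's theorem in the bidual *)

Section LocalReflexivity.
Variables (R : realType) (k : scalar_kind) (X : normedModType (scalars R k)).
Local Notation K := (scalars R k).

(** Since [|phi f| / (|phi| + e) < |f|] unless [phi f = 0], some [w] in the unit ball has [|f w|]
    above this quotient, and a multiple of [w] is the required point. *)
Lemma bidual_evaluation (phi : bidual X) (f : bop X K^o) e : 0 < e ->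
  exists x : X, `|x| <= `|phi| + e /\ f x = phi f.
Proof.
move=> e0; have r0 : 0 < `|phi| + e by rewrite ltr_wpDl.
have [phif0|phif0] := eqVneq (phi f) 0.
  by exists 0; rewrite normr0 linear0 phif0 ltW.
have phif : `|phi f| / (`|phi| + e) < `|f|.
  have f0 : 0 < `|f|.
    by rewrite normr_gt0; apply: contra_neq phif0 => ->; rewrite linear0.
  rewrite ltr_pdivrMr// (le_lt_trans (@ler_norm_bop _ _ (dual X) K^o phi f))//.
  by rewrite mulrC ltr_pM2l// ltrDl.
have [w [w1 fw]] : exists w : X, `|w| <= 1 /\ `|phi f| / (`|phi| + e) < `|f w|.
  apply: contrapT => /forallNP nw; move: phif.
  rewrite real_ltNge ?ger0_real//; last by rewrite divr_ge0// ltW.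
  apply/negP/negPn; have [_] := opnormP f; apply=> _ [w /= w1 <-].
  have /not_andP[//|] := nw w; rewrite real_ltNge ?ger0_real//.
    by move/negP/negPn.
  by rewrite divr_ge0// ltW.
have fw0 : 0 < `|f w| by rewrite (le_lt_trans _ fw)// divr_ge0// ltW.
exists ((phi f / f w) *: w); split; last first.
  by rewrite linearZ; apply: divfK; rewrite -normr_gt0.
rewrite normrZ (@le_trans _ _ (`|phi f / f w|))//; first by rewrite ler_piMr.
by rewrite normrM normfV ler_pdivrMr// mulrC -ler_pdivrMr// ltW.
Qed.

(* Helly's theorem.  The gauge [S] on [C -> X] is that of the set of all [z]
   within [e] of a vector of values of the linear forms at some [x] with
   [`|x i| <= `|phi i| + e]; a functional separating [y] from it would contradict
   [bidual_evaluation]. *)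
Lemma local_reflexivity (I C : finType) (phi : I -> bidual X) (a : C -> I -> K)
    (y : C -> X) e :
  (forall c, \sum_i a c i *: phi i = kappa (y c)) -> 0 < e ->
  exists x : I -> X, (forall i, `|x i| <= `|phi i| + e) /\
    forall c, `|\sum_i a c i *: x i - y c| <= e.
Proof.
(* The gauge uses half of [e]; the other half pays at the end for a factor [t] slightly above 1. *)
move=> phiy e_gt0; pose d := e / 2.
have d_gt0 : 0 < d by rewrite divr_gt0.
have e_d : e = d + d by rewrite /d -splitr.
pose r i := `|phi i| + d.
have r_ge0 i : 0 <= r i by rewrite addr_ge0// ltW.
pose L (x : I -> X) c := \sum_i a c i *: x i.
pose S (z : C -> X) := [set t | 0 <= t /\ exists x : I -> X,
  (forall i, `|x i| <= t * r i) /\ forall c, `|L x c - z c| <= t * d].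
have L0 c : L (fun=> 0) c = 0 by rewrite /L big1// => i _; rewrite scaler0.
have [|||| g [glin gle gy]] := @gauge_functional R k (C -> X) S y.
- move=> z; exists (\sum_c `|z c| / d); split.
    by apply: sumr_ge0 => c _; rewrite divr_ge0// ltW.
  exists (fun=> 0); split=> [i|c].
    rewrite normr0 mulr_ge0// sumr_ge0// => c _; by rewrite divr_ge0// ltW.
  rewrite L0 sub0r normrN -ler_pdivrMr// (bigD1 c)//= lerDl sumr_ge0// => c' _.
  by rewrite divr_ge0// ltW.
- by move=> v t [].
- move=> u v s t [s0 [x [xs ux]]] [t0 [x' [xt vx]]]; split; first exact: addr_ge0.
  exists (x + x'); split=> [i|c].
    by rewrite mulrDl (le_trans (ler_normD _ _))// lerD.
  have -> : L (x + x') c - (u + v) c = (L x c - u c) + (L x' c - v c).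
    rewrite addrACA -opprD; congr (_ - _); rewrite -big_split /=.
    by apply: eq_bigr => i _; rewrite -scalerDr.
  by rewrite mulrDl (le_trans (ler_normD _ _))// lerD.
- move=> b v t [t0 [x [xt vx]]]; split; first exact: mulr_ge0.
  exists (b *: x); split=> [i|c].
    by rewrite -mulrA [leLHS](normrZ b (x i)) ler_wpM2l.
  have -> : L (b *: x) c - (b *: v) c = b *: (L x c - v c).
    rewrite scalerBr; congr (_ - _); rewrite scaler_sumr.
    by apply: eq_bigr => i _; rewrite !scalerA mulrC.
  by rewrite normrZ -mulrA ler_wpM2l.
have gD u v : g (u + v) = g u + g v by have := glin 1 u v; rewrite !scale1r.
have g0 : g 0 = 0 by apply: (addrI (g 0)); rewrite -gD !addr0.
have gsum (J : Type) (s : seq J) F : g (\sum_(j <- s) F j) = \sum_(j <- s) g (F j).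
  by elim/big_rec2 : _ => // j u v _ <-; rewrite gD.
(* The components of [g] along the coordinates are bounded functionals on [X]; the bound [d^-1]
   comes from taking [x = 0] in the gauge. *)
pose inj c (x : X) : C -> X := fun c' => if c' == c then x else 0.
have /choice[h hE] c : exists h : bop X K^o, forall x, h x = g (inj c x).
  have [||x|h [_ hE]] := @exists_bop R k X K^o (g \o inj c) d^-1.
  - move=> b u v; rewrite /= -glin; congr g; apply/funext => c'.
    rewrite /inj -[RHS]/(b *: (if _ then _ else _) + (if _ then _ else _)).
    by case: ifP => // _; rewrite scaler0 addr0.
  - by rewrite invr_ge0 ltW.
  - rewrite /= gle//; split; first by rewrite mulr_ge0// invr_ge0 ltW.
    exists (fun=> 0); split=> [i|c'].
      by rewrite normr0 !mulr_ge0// invr_ge0 ltW.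
    rewrite L0 sub0r normrN mulrC mulVKf ?gt_eqF//.
    by rewrite /inj; case: ifP => // _; rewrite normr0.
  - by exists h.
have gE z : g z = \sum_c h c (z c).
  under eq_bigr do rewrite hE.
  rewrite -gsum; congr g; apply/funext => c; rewrite fct_sumE.
  rewrite (bigD1 c)//= big1 ?addr0 => [|c' c'c]; first by rewrite /inj eqxx.
  by rewrite /inj eq_sym (negbTE c'c).
(* The transpose of [a] applied to the [h c]: [g (L x)] is the sum of the [f i (x i)] and [g y] that
   of the [phi i (f i)], so it suffices to match these values. *)
pose f i : dual X := \sum_c a c i *: (h c : dual X).
have fE i x : (f i : bop X K^o) x = \sum_c a c i * h c x by rewrite bop_sumE.
have /choice[x xP] i := @bidual_evaluation (phi i) (f i) d d_gt0.
have gyL : g y = g (L x).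
  rewrite !gE (eq_bigr (fun c => \sum_i a c i * phi i (h c))); last first.
    move=> c _; rewrite -[h c (y c)]/(kappa (y c) (h c)) -phiy.
    by rewrite (@bop_sumE R k (dual X) K^o).
  rewrite exchange_big [RHS](eq_bigr (fun c => \sum_i a c i * h c (x i))) /=.
    rewrite [RHS]exchange_big; apply: eq_bigr => i _ /=.
    rewrite -fE (xP i).2 linear_sum; apply: eq_bigr => c _.
    by rewrite linearZ.
  by move=> c _; rewrite linear_sum; apply: eq_bigr => i _; rewrite linearZ.
have g_le1 : g y <= 1.
  have g_ge0 : 0 <= g y by apply: gy => t [].
  rewrite -(ger0_norm g_ge0) gyL gle//; split=> //; exists x; split=> [i|c].
    by rewrite mul1r; exact: (xP i).1.
  by rewrite subrr normr0 mul1r ltW.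
(* [s] dominates [d] and all [r i], so that a factor below [1 + d / s] increases each of them by at
   most [d]. *)
pose s := 1 + \sum_i `|phi i| + d.
have phi_le i : r i <= s.
  rewrite /r /s lerD2r (bigD1 i)//= addrCA lerDl addr_ge0//.
  by rewrite sumr_ge0.
have d_le : d <= s by rewrite /s lerDr addr_ge0// sumr_ge0.
have s_gt0 : 0 < s by rewrite (lt_le_trans d_gt0).
(* Otherwise [1 + d / s] would be a lower bound of [S y], hence at most [g y], which is at most
   1. *)
have [t [t_ge0 [x' [xr x'y]]] t_lt] : exists2 t, S y t & t < 1 + d / s.
  apply: contrapT => /forall2NP nS.
  have : 1 + d / s <= 1.
    apply: le_trans g_le1; apply: gy => t St; have [//|/negP] := nS t.
    rewrite -real_leNgt//; first by rewrite ger0_real// addr_ge0// divr_ge0// ltW.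
    by case: St => t0 _; rewrite ger0_real.
  by rewrite gerDl => /(lt_le_trans (divr_gt0 d_gt0 s_gt0)); rewrite ltxx.
have t_le u : 0 <= u -> u <= s -> t * u <= u + d.
  move=> u0 us; apply: (@le_trans _ _ ((1 + d / s) * u)).
    by rewrite ler_wpM2r// ltW.
  by rewrite mulrDl mul1r lerD2l mulrAC ler_pdivrMr// ler_pM2l.
exists x'; split=> [i|c].
  by rewrite (le_trans (xr i))// (le_trans (t_le _ _ _))// e_d addrA.
by rewrite (le_trans (x'y c))// e_d t_le// ltW.
Qed.
End LocalReflexivity.

(** * Invariant means on quotients and on commutative semigroups *)

Section Amenability.
Variables (R : realType) (k : scalar_kind).
Local Notation K := (scalars R k).

(** The Archimedean property, read off the real parts in [R[i]]. *)
Lemma scalars_natmul_bounded (x C : K) : 0 <= x ->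
  (forall n, x *+ n <= C) -> x = 0.
Proof.
case: k x C => /= x C x0 xC.
  apply/eqP; rewrite eq_le x0 andbT leNgt; apply/negP => xgt0.
  have := xC (Num.bound (C / x)); rewrite leNgt => /negP; apply.
  by rewrite -mulr_natr mulrC -ltr_pdivrMr// archi_boundP// divr_ge0// (le_trans _ (xC 0%N)).
have xE : x = (complex.Re x)%:C%C by rewrite RRe_real// ger0_real.
apply/eqP; rewrite eq_le x0 andbT xE lecR leNgt; apply/negP => xgt0.
have xC' n : complex.Re x *+ n <= complex.Re C.
  by have := xC n; rewrite lecE => /andP[_]; rewrite {1}xE -rmorphMn.
have := xC' (Num.bound (complex.Re C / complex.Re x)).
rewrite leNgt => /negP; apply.
rewrite -mulr_natr mulrC -ltr_pdivrMr// archi_boundP// divr_ge0//; last exact: ltW.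
exact: (le_trans _ (xC' 0%N)).
Qed.

Lemma ler_norm_sum_size (X : normedModType K) (I : Type) (s : seq I)
    (F : I -> X) (c : K) :
  (forall i, `|F i| <= c) -> `|\sum_(i <- s) F i| <= c * (size s)%:R.
Proof.
move=> Fc; elim: s => [|i s IHs]; first by rewrite big_nil normr0 mulr0.
by rewrite big_cons mulrS mulrDr mulr1 (le_trans (ler_normD _ _))// lerD.
Qed.

(* A functional bounded by the infimum of [sup_t |1/|J| sum_(j in J) f (t j)|]
   over the finite families [J] is invariant, because averaging over the powers
   of [s] nearly annihilates [f - sf]. *)
Lemma commutative_amenable (S : semigroupType) (s0 : S) :
  (forall s t : S, s * t = t * s)%g -> amenable R k S.
Proof.
move=> mulC.
pose gauge (f : linfty S K^o) := [set c : K | 0 <= c /\ exists J : seq S,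
  J != [::] /\ forall t, `|\sum_(j <- J) f (t * j)%g| <= c * (size J)%:R].
pose one : linfty S K^o := linfty_cst S (1 : K^o).
have gauge_norm f : gauge f `|f|.
  split=> //; exists [:: s0]; split=> // t; rewrite big_seq1 mulr1.
  exact: ler_norm_linfty.
have [|||| g [glin gle g1]] := @gauge_functional R k (linfty S K^o) gauge one.
- by move=> f; exists `|f|.
- by move=> f t [].
- move=> f h c d [c0 [J [J0 fJ]]] [d0 [H [H0 hH]]]; split; first exact: addr_ge0.
  (* Averaging over all products keeps both bounds: the sum over [j] controls [f] and, by
     commutativity, the sum over [i] controls [h]. *)
  exists [seq (i * j)%g | i <- H, j <- J]; split.
    by move: H0 J0; rewrite -!size_eq0 size_allpairs muln_eq0 negb_or => -> ->.
  move=> t; rewrite size_allpairs natrM big_allpairs_dep.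
  rewrite (eq_bigr (fun i => \sum_(j <- J) f (t * i * j)%g +
                             \sum_(j <- J) h (t * j * i)%g)).
    rewrite big_split /= [X in _ + X]exchange_big mulrDl.
    rewrite (le_trans (ler_normD _ _))// lerD//.
      by rewrite mulrCA mulrC; exact: ler_norm_sum_size.
    by rewrite mulrA; exact: ler_norm_sum_size.
  move=> i _; rewrite -big_split; apply: eq_bigr => j _.
  by rewrite mulgA -[in RHS](mulgA t j) (mulC j) mulgA.
- move=> a f t [t0 [J [J0 fJ]]]; split; first exact: mulr_ge0.
  exists J; split=> // u.
  rewrite -scaler_sumr [leLHS]normrZ -mulrA.
  by apply: ler_wpM2l => //; exact: fJ.
have [m [m1 mE]] : exists m : bop (linfty S K^o) K^o, `|m| <= 1 /\ forall f, m f = g f.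
  apply: exists_bop glin ler01 _ => f; rewrite mul1r; apply: gle; exact: gauge_norm.
have mone : m one = 1.
  apply/eqP; rewrite eq_le; apply/andP; split; last first.
    rewrite mE; apply: g1 => c [c0 [J [J0 /(_ s0)]]].
    rewrite big_const_seq count_predT iter_addr_0 normr_nat.
    by rewrite ler_pMl// ltr0n lt0n size_eq0.
  have g0 : 0 <= g one by apply: g1 => c [].
  rewrite mE -(ger0_norm g0) (le_trans (gle _ _ (gauge_norm _)))//.
  by apply: norm_linfty_le => // s; rewrite normr1.
have minv s f : m (ltranslate s f) = m f.
  apply/eqP; rewrite -subr_eq0 -normr_eq0; apply/eqP.
  apply: (@scalars_natmul_bounded _ (`|f| *+ 2)) => // n.
  have [->|n0] := eqVneq n 0%N; first by rewrite mulr0n mulrn_wge0.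
  rewrite -mulr_natr -ler_pdivlMr ?ltr0n ?lt0n//.
  have -> : m (ltranslate s f) - m f = g (ltranslate s f - f).
    by rewrite -mE linearB.
  apply: gle; split.
    by rewrite divr_ge0 // mulrn_wge0.
  (* The powers of [s], starting from [s] itself for want of a unit. The sum telescopes to two
     terms, each bounded by [|f|]. *)
  pose p i := iter i (fun t => s * t)%g s.
  exists [seq p i | i <- iota 0 n]; rewrite -!size_eq0 size_map size_iota; split=> // t.
  rewrite big_map divfK ?pnatr_eq0//.
  rewrite (eq_bigr (fun i => f (t * p i.+1)%g - f (t * p i)%g)); last first.
    move=> i _; rewrite -[LHS]/(f (s * (t * p i))%g - f (t * p i)%g).
    by rewrite mulgA (mulC s) -mulgA.
  have := telescope_sumr (fun i => f (t * p i)%g) (leq0n n).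
  rewrite /index_iota subn0 => ->; rewrite mulr2n (le_trans (ler_normB _ _))// lerD//;
  exact: ler_norm_linfty.
exists m; split=> // [x|s f].
  have -> : linfty_cst S x = x *: one by apply: linfty_ext => s; rewrite -[RHS]/(x * 1) mulr1.
  by rewrite linearZ /= mone -[LHS]/(x * 1) mulr1.
split; first by rewrite minv.
rewrite -(minv s); congr (m _); apply: linfty_ext => t.
by rewrite -[LHS]/(f (s * t)%g) mulC.
Qed.

End Amenability.

(** * Free modules and additive coordinates on a vector space *)

Section FreeModule.
Variables (R : nzRingType) (I : choiceType).
Local Notation coeff := (@coeff R I).

Section Lift.
Variables (V : lmodType R) (f : I -> V).
Local Notation lift := (fglift f).

Lemma fgliftE (D : {freeg I / R}) :
  lift D = \sum_(i <- dom D) coeff i D *: f i.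
Proof. by rewrite -{1}(Freeg_dom D) fglift_Freeg [LHS]big_map. Qed.

Lemma fglift_linear : linear lift.
Proof.
pose liftB := lift_is_additive f.
have lift0 : lift 0 = 0 by rewrite -{1}(subrr 0) liftB subrr.
have liftD u v : lift (u + v) = lift u + lift v.
  by rewrite -[v in LHS]opprK -[- v]add0r !liftB lift0 sub0r opprK.
move=> a u v; rewrite liftD; congr (_ + _).
rewrite -[a *: u]/(fgscale a u) /fgscale (fgliftE u) scaler_sumr.
elim/big_rec2 : _ => [|i x y _ <-]; first exact: lift0.
by rewrite liftD liftU scalerA.
Qed.

End Lift.
End FreeModule.

(* The image of [c] is a complement of the kernel of the evaluation map
   [{freeg V / F} -> V]. *)
Lemma free_module_section (F : fieldType) (V : lmodType F) :
  exists c : V -> {freeg V / F}, (forall u v, c (u + v) = c u + c v) /\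
    forall v, \sum_(x <- dom (c v)) coeff x (c v) *: x = v.
Proof.
pose e : {freeg V / F} -> V := fglift id.
have elin : linear e by exact: fglift_linear.
have e0 : e 0 = 0 by have := elin (-1) 0 0; rewrite scaler0 addr0 scaleN1r addNr.
have [||U [Us U0 Uker Umax]] := @maximal_subspace F {freeg V / F}
    [set u | e u = 0 -> u = 0] [set 0].
- by split=> // a _ _ -> ->; rewrite scaler0 addr0.
- by move=> _ -> _.
have Uinj u v : U u -> U v -> e u = e v -> u = v.
  move=> Uu Uv uv; apply/eqP; rewrite -subr_eq0; apply/eqP.
  have -> : u - v = (-1) *: v + u by rewrite scaleN1r addrC.
  by apply: Uker; [exact: Us.2|rewrite elin uv scaleN1r addNr].
have /choice[c cP] v : exists u, U u /\ e u = v.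
  pose w : {freeg V / F} := Freeg [:: (1, v)].
  have ew : e w = v by rewrite /e liftU scale1r.
  have [Uw|nUw] := pselect (U w); first by exists w.
  (* By maximality some nonzero [a *: w + u] with [u] in [U] lies in the kernel. Then [a] is
     nonzero, and [- a^-1 *: u] is mapped to [v]. *)
  have : ~ forall a u, U u -> e (a *: w + u) = 0 -> a *: w + u = 0.
    by move=> H; apply: nUw; apply: Umax => a u Uu; exact: H.
  move=> /existsNP[a /existsNP[u /not_implyP[Uu /not_implyP[ewu wu0]]]].
  have [a0|a0] := eqVneq a 0.
    by case: wu0; move: ewu; rewrite a0 scale0r add0r; exact: Uker.
  exists (- a^-1 *: u); split; first exact: subspace_scale.
  have := elin (- a^-1) u 0; rewrite !addr0 e0 addr0 => ->.
  move: ewu; rewrite elin ew => /eqP; rewrite addrC addr_eq0 => /eqP ->.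
  by rewrite scaleNr scalerN opprK scalerA mulVf// scale1r.
exists c; split=> [u v|v]; last by rewrite -[RHS](cP v).2 /e fgliftE.
have [Uu eu] := cP u; have [Uv ev] := cP v; have [Uuv euv] := cP (u + v).
have cE : c u + c v = 1 *: c u + c v by rewrite scale1r.
apply: Uinj => //; first by rewrite cE; exact: Us.2.
by rewrite cE elin eu ev euv scale1r.
Qed.

(** * Means obtained from a projection and from quotient maps *)

Section Means.
Variables (R : realType) (k : scalar_kind).
Local Notation K := (scalars R k).

Lemma complemented_has_invariant_mean (X : normedModType K) (lambda : K)
    (S : semigroupType) :
  complemented_in_bidual X lambda -> amenable R k S ->
  has_invariant_mean S X lambda.
Proof.
move=> [P [PP Prange Ple]] [m [m1 mcst minv]].
have lambda0 : 0 <= lambda by exact: le_trans Ple.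
have Pkappa x : P (kappa x) = kappa x.
  have : range P (kappa x) by rewrite Prange; exists x.
  by case=> phi _ <-.
(* This provides the scalar functions [g \o f] to which [m] is applied. *)
have /choice[c' cE'] (x : linfty S X * bop X K^o) :
    exists u : linfty S K^o, forall s, u s = x.2 (x.1 s).
  apply: (@exists_linfty R k S K^o _ (`|x.2| * `|x.1|)) => s.
  rewrite (le_trans (@ler_norm_bop R k X K^o x.2 _))// ler_wpM2l//.
  exact: ler_norm_linfty.
pose c f g := c' (f, g).
have cE f g s : c f g s = g (f s) by exact: cE'.
have /choice[phi phiP] (f : linfty S X) : exists phi : bidual X,
    `|phi| <= `|f| /\ forall g : bop X K^o, phi g = m (c f g).
  have [||g|phi] := @exists_bop R k (dual X) K^o (fun g => m (c f g)) `|f|.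
  - move=> a g h; rewrite -linearP; congr (m _); apply: linfty_ext => s.
    by rewrite -[RHS]/(a *: c f g s + c f h s) !cE.
  - by [].
  - rewrite (le_trans (ler_norm_bop _ _))// -[leRHS]mul1r ler_pM//.
    apply: norm_linfty_le => [|s]; first exact: mulr_ge0.
    rewrite cE mulrC (le_trans (@ler_norm_bop R k X K^o g (f s)))// ler_wpM2l//.
    exact: ler_norm_linfty.
  - by exists phi.
have /choice[M ME] f : exists x, kappa x = P (phi f).
  have : range (@kappa R k X) (P (phi f)) by rewrite -Prange; exists (phi f).
  by case=> x _; exists x.
have Mlin : linear M.
  move=> a u v; apply: (@kappa_inj R k); rewrite kappa_linear !ME -linearP.
  congr (P _); apply: bop_ext => g.
  rewrite -[RHS]/(a *: (phi u : bop (dual X) K^o) g + phi v g) !(phiP _).2.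
  rewrite -linearP; congr (m _); apply: linfty_ext => s.
  by rewrite -[RHS]/(a *: c u g s + c v g s) !cE -linearP.
have [f|T [Tle TE]] := exists_bop Mlin lambda0.
  rewrite -norm_kappa ME (le_trans (ler_norm_bop _ _))// ler_pM//.
  exact: (phiP f).1.
exists T; split=> // [x|s f].
  rewrite TE; apply: (@kappa_inj R k); rewrite ME -Pkappa; congr (P _).
  apply: bop_ext => g; rewrite (phiP _).2 -[RHS](mcst (g x)); congr (m _).
  by apply: linfty_ext => s; rewrite cE.
rewrite !TE; split; apply: (@kappa_inj R k); rewrite !ME; congr (P _);
  apply: bop_ext => g; rewrite !(phiP _).2.
  have [-> _] := minv s (c f g); congr (m _); apply: linfty_ext => t.
  by rewrite cE -[LHS]/(c f g (s * t)%g) cE.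
have [_ ->] := minv s (c f g); congr (m _); apply: linfty_ext => t.
by rewrite cE -[LHS]/(c f g (t * s)%g) cE.
Qed.

(** Functions on [S'] are pulled back along [p]; by surjectivity each translation of [S'] is induced
    by one of [S]. *)
Lemma invariant_mean_quotient (X : normedModType K) (lambda : K)
    (S S' : semigroupType) (p : S -> S') :
  (forall s t, p (s * t) = p s * p t)%g -> (forall s', exists s, p s = s') ->
  has_invariant_mean S X lambda -> has_invariant_mean S' X lambda.
Proof.
move=> pM psurj [M [Mle Mcst Minv]].
have lambda0 : 0 <= lambda by exact: le_trans Mle.
have /choice[c cE] (f : linfty S' X) : exists c : linfty S X, forall s, c s = f (p s).
  by apply: exists_linfty => s; exact: ler_norm_linfty.
have [||f|T [Tle TE]] := @exists_bop R k (linfty S' X) X (fun f => M (c f)) lambda.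
- move=> a u v; rewrite -linearP; congr (M _); apply: linfty_ext => s.
  by rewrite -[RHS]/(a *: c u s + c v s) !cE.
- by [].
- rewrite (le_trans (ler_norm_bop _ _))// ler_pM//.
  by apply: norm_linfty_le => // s; rewrite cE; exact: ler_norm_linfty.
exists T; split=> // [x|s' f]; rewrite !TE.
  by rewrite -[RHS]Mcst; congr (M _); apply: linfty_ext => s; rewrite cE.
have [s <-] := psurj s'; split.
  have [-> _] := Minv s (c f); congr (M _); apply: linfty_ext => t.
  by rewrite cE -[LHS]/(c f (s * t)%g) cE pM.
have [_ ->] := Minv s (c f); congr (M _); apply: linfty_ext => t.
by rewrite cE -[LHS]/(c f (t * s)%g) cE pM.
Qed.

Lemma free_abelian_amenable (I : choiceType) (G : groupType) :
  free_abelian_group_of_rank I G -> amenable R k G.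
Proof.
move=> [phi [psi phiK psiK]]; apply: (commutative_amenable R k (1%g : G)) => s t.
by rewrite -(psiK s) -(psiK t) -!gmulfM; congr (phi _); exact: addrC.
Qed.

Lemma free_abelian_mean_zmodule (X : normedModType K) (lambda : K) (V : zmodType) :
  (forall G : groupType, free_abelian_group_of_rank V G ->
     has_invariant_mean G X lambda) ->
  has_invariant_mean (Algebra.to_multiplicative V) X lambda.
Proof.
move=> meanV; pose F := Algebra.to_multiplicative {freeg V}.
pose p (u : F) : Algebra.to_multiplicative V :=
  @fglift _ (zmodule V) V id (u : {freeg V}).
apply: (@invariant_mean_quotient X lambda F _ p).
- move=> s t; have := @fglift_linear int V (zmodule V) id 1 s t; rewrite !scale1r; exact.
- move=> v; exists (Freeg [:: (1, v)]). rewrite /p liftU.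
  exact: (scale1r (v : zmodule V)).
- by apply: meanV; exists idfun; exists idfun.
Qed.

End Means.

(** * The projection obtained from a mean on the bidual *)

Section MeanFilter.
Variables (R : realType) (k : scalar_kind) (X : normedModType (scalars R k)).
Local Notation K := (scalars R k).
Variables (V : zmodType) (lambda : K).
Local Notation G := (Algebra.to_multiplicative V).
Variable M : bop (linfty G X) X.
Hypothesis M_mean : invariant_mean lambda M.

(** The sets of full measure for [M]: modifying a function off such a set does not change its mean.
    This is the sense of almost every [g]. *)
Definition mean_filter : set_system V :=
  [set P | forall f : linfty G X, (forall g, P g -> f g = 0) -> M f = 0].

Lemma linfty_truncation (f : linfty G X) (P : set V) :
  exists h : linfty G X, forall g, h g = if `[< P g >] then f g else 0.
Proof.
apply: (@exists_linfty _ _ _ _ _ `|f|) => s; case: ifP => _.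
  exact: ler_norm_linfty.
by rewrite normr0.
Qed.

#[local] Instance mean_filter_filter : Filter mean_filter.
Proof.
split.
- move=> f f0; have -> : f = 0 by apply: linfty_ext => g; exact: f0.
  exact: linear0.
- move=> P Q MP MQ f f0.
  (* The part of [f] on [P] vanishes on [Q], and the remaining part vanishes on [P]. *)
  have [h hE] := linfty_truncation f P.
  have -> : M f = M (f - h) + M h by rewrite -linearD subrK.
  rewrite (MP (f - h)) ?(MQ h) ?addr0// => g Pg.
    by rewrite hE; case: asboolP => // Pg'; exact: f0.
  by rewrite -[LHS]/(f g - h g) hE asboolT// subrr.
- by move=> P Q PQ MP f f0; apply: MP => g Pg; apply: f0; exact: PQ.
Qed.

(** Truncating [f] to where the bound holds leaves [M f] unchanged and makes the bound hold
    everywhere; the error [n.+1%:R^-1] disappears by the Archimedean property. *)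
Lemma norm_mean_le (f : linfty G X) (d : K) : 0 <= d ->
  (forall n, mean_filter [set g | `|f g| <= d + n.+1%:R^-1]) ->
  `|M f| <= lambda * d.
Proof.
move=> d0 fd; have [Mle _ _] := M_mean.
have lambda0 : 0 <= lambda by exact: le_trans Mle.
have Mf n : `|M f| <= lambda * (d + n.+1%:R^-1).
  have [h hE] := linfty_truncation f [set g | `|f g| <= d + n.+1%:R^-1].
  have -> : M f = M (f - h) + M h by rewrite -linearD subrK.
  rewrite (fd n (f - h)) ?add0r => [|g fg]; last first.
    by rewrite -[LHS]/(f g - h g) hE asboolT// subrr.
  rewrite (le_trans (ler_norm_bop _ _))// ler_pM//.
  apply: norm_linfty_le => [|g]; first by rewrite addr_ge0// invr_ge0.
  by rewrite hE; case: asboolP => //; rewrite normr0 addr_ge0// invr_ge0.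
have fr : `|M f| - lambda * d \is Num.real by rewrite rpredB ?ger0_real ?mulr_ge0.
rewrite -subr_le0; have /orP[//|f_ge0] := real_leVge fr (real0 _).
suff -> : `|M f| - lambda * d = 0 by [].
apply: (scalars_natmul_bounded (C := lambda)) => // -[|n]; first by rewrite mulr0n.
by rewrite -mulr_natr -ler_pdivlMr// lerBlDl -mulrDr.
Qed.

(* The sets [{g | `|c g| <= N}] have arbitrarily many disjoint translates. *)
Lemma mean_filter_unbounded (c : V -> rat) (w : V) (N : nat) :
  (forall u v, c (u + v) = c u + c v) -> c w != 0 ->
  mean_filter [set g | N%:R < `|c g|].
Proof.
move=> cD cw f f0; have [Mle _ Minv] := M_mean.
have c0 : c 0 = 0 by apply: (addrI (c 0)); rewrite -cD !addr0.
have cMn v n : c (v *+ n) = c v *+ n.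
  by elim: n => [|n IHn]; rewrite ?mulr0n// !mulrS cD IHn.
(* With [|c (w *+ m)|] above [2 N], translates by distinct multiples of [w *+ m] of the set where
   [|c|] is at most [N] are disjoint. *)
pose m := Num.bound (N.*2%:R / `|c w|).
have cm : N.*2%:R < `|c (w *+ m)|.
  rewrite cMn normrMn -[ltRHS]mulr_natl -ltr_pdivrMr ?normr_gt0//.
  by rewrite archi_boundP// divr_ge0.
pose F i := ltranslate (w *+ m *+ i : G) f.
have MF i : M (F i) = M f by have [<- _] := Minv (w *+ m *+ i : G) f.
have FE i g : F i g = f (w *+ m *+ i + g) by [].
apply/eqP; rewrite -normr_eq0; apply/eqP.
apply: (@scalars_natmul_bounded R k _ (lambda * `|f|)) => // n.
(* The [n] translates of [f] have the same mean and disjoint supports, so that their sum is still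
   bounded by [|f|]. *)
have -> : `|M f| *+ n = `|M (\sum_(i < n) F i)|.
  rewrite linear_sum (eq_bigr (fun=> M f)) => [|i _]; last exact: MF.
  by rewrite sumr_const card_ord normrMn.
rewrite (le_trans (ler_norm_bop _ _))// ler_pM//.
apply: norm_linfty_le => // g.
have -> : (\sum_(i < n) F i) g = \sum_(i < n) f (w *+ m *+ i + g).
  by elim/big_ind2 : _ => // u v a b <- <-.
have [[i fi]|allf] := pselect (exists i : 'I_n, f (w *+ m *+ i + g) <> 0).
  rewrite (bigD1 i)//= big1 ?addr0; first exact: ler_norm_linfty.
  move=> j ji; apply: contrapT => fj.
  have small h : f h <> 0 -> `|c h| <= N%:R.
    by move=> fh; rewrite leNgt; apply/negP => /f0.
  have := le_trans (ler_normB _ _) (lerD (small _ fj) (small _ fi)).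
  rewrite !cD !(cMn (w *+ m)) opprD addrACA subrr addr0 -natrD addnn => cij.
  suff /(lt_le_trans (le_lt_trans cij cm)) :
      `|c (w *+ m)| <= `|c (w *+ m) *+ j - c (w *+ m) *+ i| by rewrite ltxx.
  rewrite -(mulr_natr _ j) -(mulr_natr _ i) -mulrBr normrM.
  rewrite ler_peMr// !pmulrn -intrB norm_intr_ge1// ?intr_int//.
  by rewrite intr_eq0 subr_eq0.
by rewrite big1 ?normr0// => i _; apply: contrapT => fi; apply: allf; exists i.
Qed.

End MeanFilter.

(** * Approximate retractions on finite subsets of the bidual *)

Section FiniteApproximation.
Variables (R : realType) (k : scalar_kind) (X : normedModType (scalars R k)).
Local Notation K := (scalars R k).

(* When [u = 0] the point [a *: u + v] does not determine [a], and one finite set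
   of conditions on [T] could not handle all [a]. *)
Definition almost_linear_retraction (s : seq (bidual X)) (e : K)
    (T : bidual X -> X) :=
  [/\ forall phi, phi \in s -> `|T phi| <= `|phi| + e,
      forall a u v, u != 0 -> u \in s -> v \in s -> a *: u + v \in s ->
        `|T (a *: u + v) - (a *: T u + T v)| <= e
    & forall x, kappa x \in s -> `|T (kappa x) - x| <= e].

(** Local reflexivity is applied with one unknown for each member of [s], one equation for each
    triple of members and one for each member. *)
Lemma exists_almost_linear_retraction (s : seq (bidual X)) (e : K) : 0 < e ->
  exists T, almost_linear_retraction s e T.
Proof.
move=> e0; pose I := seq_sub s.
have /choice[b bP] (t : I * I * I) : exists a : option K,
    if a is Some a then val t.2 = a *: val t.1.1 + val t.1.2
    else forall a, val t.2 <> a *: val t.1.1 + val t.1.2.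
  have [[a aP]|n] := pselect (exists a, val t.2 = a *: val t.1.1 + val t.1.2).
    by exists (Some a).
  by exists None => a aP; apply: n; exists a.
have /choice[z zP] (i : I) : exists z : option X,
    if z is Some z then val i = kappa z else forall x, val i <> kappa x.
  have [[x xP]|n] := pselect (exists x, val i = kappa x).
    by exists (Some x).
  by exists None => x xP; apply: n; exists x.
pose delta (i j : I) : K := (j == i)%:R.
have deltaE (Y : normedModType K) (y : I -> Y) i : \sum_j delta i j *: y j = y i.
  rewrite (bigD1 i)//= /delta eqxx scale1r big1 ?addr0// => j /negbTE ->.
  by rewrite scale0r.
have delta3E (Y : normedModType K) (y : I -> Y) a i j l :
    \sum_m (delta l m - (a * delta i m + delta j m)) *: y m = y l - (a *: y i + y j).
  under eq_bigr do rewrite scalerBl scalerDl -scalerA.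
  by rewrite sumrB big_split /= -scaler_sumr !deltaE.
(* A triple without a relation, or a member outside the image of [kappa], contributes the trivial
   equation [0 = 0]. *)
pose A (c : I * I * I + I) m : K := match c with
  | inl t => if b t is Some a then
               delta t.2 m - (a * delta t.1.1 m + delta t.1.2 m) else 0
  | inr i => if z i is Some _ then delta i m else 0 end.
pose y (c : I * I * I + I) : X := match c with
  | inl t => 0 | inr i => if z i is Some x then x else 0 end.
have k0 : kappa (0 : X) = 0 by apply: bop_ext => f; exact: linear0.
have [|//|x [xle xA]] := @local_reflexivity R k X I _ val A y e.
  move=> [t|i] /=.
    rewrite k0; case: (b t) (bP t) => [a|] tP.
      by rewrite delta3E tP subrr.
    by rewrite big1// => m _; rewrite scale0r.
  case: (z i) (zP i) => [x|] iP; first by rewrite deltaE.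
  by rewrite k0 big1// => m _; rewrite scale0r.
exists (fun phi => if insub phi is Some i then x i else 0); split.
- by move=> phi phis; rewrite insubT; exact: xle.
- move=> a u v u0 us vs ws; rewrite !insubT.
  pose t : I * I * I := (SeqSub us, SeqSub vs, SeqSub ws).
  have := xA (inl t); rewrite /= subr0; case: (b t) (bP t) => [a'|] /=.
    (* The coefficient chosen for the triple is [a] itself, because [u] is nonzero. *)
    have [<- _|aa'] := eqVneq a a'; first by rewrite delta3E.
    move=> /addIr/eqP; rewrite -subr_eq0 -scalerBl scaler_eq0 (negbTE u0) orbF.
    by rewrite subr_eq0 (negbTE aa').
  by move=> /(_ a).
- move=> y' ys; rewrite insubT; have := xA (inr (SeqSub ys)) => /=.
  case: (z _) (zP (SeqSub ys)) => [y''|/(_ y')//] /= /kappa_inj <-.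
  by rewrite deltaE.
Qed.

End FiniteApproximation.

(** * Finite sets containing almost surely any given vector *)

Section RationalCombinations.
Variable V : lmodType rat.

(** Countability makes these finite sets exhaust [rat] as [n] grows; this is why the bidual is
    viewed as a rational vector space. *)
Definition first_rationals (n : nat) : seq rat :=
  pmap choice.unpickle (iota 0 n).

Fixpoint rational_combinations (n : nat) (s : seq V) : seq V :=
  if s is x :: s' then
    [seq q *: x + v | q <- first_rationals n, v <- rational_combinations n s']
  else [:: 0].

Lemma mem_rational_combinations n s (a : V -> rat) :
  (forall x, x \in s -> choice.pickle (a x) < n)%N ->
  \sum_(x <- s) a x *: x \in rational_combinations n s.
Proof.
elim: s => [|x s IHs] an; first by rewrite big_nil /= mem_seq1.
rewrite big_cons /=; apply/allpairsP.
exists (a x, \sum_(y <- s) a y *: y); split=> //=.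
  rewrite mem_pmap; apply/mapP; exists (choice.pickle (a x)); last by rewrite choice.pickleK.
  by rewrite mem_iota add0n an// mem_head.
by apply: IHs => y ys; rewrite an// in_cons ys orbT.
Qed.

End RationalCombinations.

Section AlmostEverywhereCover.
Variables (R : realType) (k : scalar_kind) (X : normedModType (scalars R k)).
Variables (V : lmodType rat) (lambda : scalars R k).
Local Notation G := (Algebra.to_multiplicative V).
Variable M : bop (linfty G X) X.
Hypothesis M_mean : invariant_mean lambda M.

(** [s g] collects the combinations of the points occurring in [c g] with coefficients of code below
    [n g]. For almost every [g] these points include those occurring in [c v], and [n g] exceeds the
    codes of their coefficients. *)
Lemma mean_filter_finite_sets : (exists w : V, w != 0) ->
  exists (n : V -> nat) (s : V -> seq V),
    (forall N, mean_filter M [set g | (N <= n g)%N]) /\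
    forall v, mean_filter M [set g | v \in s g].
Proof.
move=> [w w0]; have [c [cD cE]] := free_module_section V.
have FF : Filter (mean_filter M) by exact: mean_filter_filter.
have large u x N : coeff x (c u) != 0 ->
    mean_filter M [set g | N%:R < `|coeff x (c g)|].
  move=> xu; pose cx g := coeff x (c g).
  apply: (@mean_filter_unbounded _ _ _ _ _ _ M_mean cx u) => //.
  by move=> u' v'; rewrite /cx cD coeffD.
pose n g := \max_(x <- dom (c g)) Num.truncn `|coeff x (c g)|.
have n_large N : mean_filter M [set g | (N <= n g)%N].
  have [x xw] : exists x, coeff x (c w) != 0.
    apply: contrapT => /forallNP nx; move: w0; rewrite -[w]cE big_seq big1 ?eqxx//.
    by move=> x; rewrite mem_dom => xw; case: (nx x).
  apply: (@filterS _ _ FF _ _ _ (large w x N xw)) => g /= xg.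
  have xdom : x \in dom (c g).
    by rewrite mem_dom -normr_gt0 (le_lt_trans _ xg).
  rewrite (leq_trans _ (leq_bigmax_seq _ xdom _))//.
  by rewrite truncn_ge_nat// ltW.
exists n, (fun g => rational_combinations (n g) (dom (c g))); split=> // v.
pose N := \max_(x <- dom (c v)) (choice.pickle (coeff x (c v))).+1.
have dom_sub (s : seq V) : {subset s <= dom (c v)} ->
    mean_filter M [set g | {subset s <= dom (c g)}].
  elim: s => [|x s IHs] sv; first by apply: (@filterS _ _ FF _ _ _ (@filterT _ _ FF)) => g _.
  have xv : coeff x (c v) != 0 by rewrite -mem_dom sv// mem_head.
  have sub : {subset s <= dom (c v)} by move=> y ys; rewrite sv// in_cons ys orbT.
  apply: (@filterS2 _ _ FF _ _ _ _ (large v x 0%N xv) (IHs sub)) => g /= xg sg y.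
  rewrite in_cons => /orP[/eqP->|/sg//].
  by rewrite mem_dom -normr_gt0.
(* Points of [dom (c g)] outside [dom (c v)] receive the coefficient 0, whose code must therefore
   lie below [n g] too. *)
apply: (@filterS3 _ _ FF _ _ _ _ _ (dom_sub _ (fun=> id)) (n_large N)
  (n_large (choice.pickle (0 : rat)).+1)).
move=> g /= vg Ng N0.
have -> : v = \sum_(x <- dom (c g)) coeff x (c v) *: x.
  rewrite -[LHS]cE [RHS](bigID (mem (dom (c v)))) /= [X in _ + X]big1 ?addr0; last first.
    by move=> x /coeff_outdom ->; rewrite scale0r.
  rewrite -[RHS]big_filter; apply: perm_big; apply: uniq_perm.
  - exact: uniq_dom.
  - by rewrite filter_uniq// uniq_dom.
  - by move=> x; rewrite mem_filter; case: (boolP (x \in dom (c v))) => //= /vg.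
apply: mem_rational_combinations => x _.
have [xv|/coeff_outdom ->//] := boolP (x \in dom (c v)).
by rewrite (leq_trans _ Ng)// (leq_trans _ (leq_bigmax_seq _ xv _)).
Qed.

End AlmostEverywhereCover.

(** * From the mean to the projection *)

Section Complementation.
Variables (R : realType) (k : scalar_kind) (X : normedModType (scalars R k)).
Local Notation K := (scalars R k).

Lemma invariant_mean_complemented (lambda : K) : 0 <= lambda ->
  has_invariant_mean (Algebra.to_multiplicative (bidual X)) X lambda ->
  complemented_in_bidual X lambda.
Proof.
move=> lambda0 [M M_mean]; have [_ Mcst _] := M_mean.
(* A bounded left inverse [P] of [kappa] yields the projection [kappa \o P]. *)
suff [P [Plin Pnorm Pkappa]] : exists P : bidual X -> X,
    [/\ linear P, forall phi, `|P phi| <= lambda * `|phi|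
      & forall x, P (kappa x) = x].
  have [||phi|Q [Qle QE]] :=
      @exists_bop R k (bidual X) (bidual X) (@kappa R k X \o P) lambda.
  - by move=> a u v /=; rewrite Plin kappa_linear.
  - by [].
  - by rewrite /= norm_kappa.
  exists Q; split=> //; first by move=> phi; rewrite !QE /= Pkappa.
  rewrite eqEsubset; split=> [_ [phi _ <-]|_ [x _ <-]].
    by rewrite QE; exists (P phi).
  by exists (kappa x) => //; rewrite QE /= Pkappa.
(* The generic coordinates require a nonzero vector; if the bidual is zero, so is [X], and [P = 0]
   works. *)
have [[phi0 phi0_neq0]|bidual0] := pselect (exists phi : bidual X, phi != 0); last first.
  have all0 (phi : bidual X) : phi = 0.
    by apply: contrapT => /eqP phi0; apply: bidual0; exists phi.
  exists (fun=> 0); split=> [a u v|phi|x]; first by rewrite scaler0 addr0.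
    by rewrite normr0 mulr_ge0.
  by apply: (@kappa_inj R k); rewrite [LHS]all0 [RHS]all0.
pose VQ := restrict_scalars (@ratr K : {rmorphism rat -> K}) (bidual X).
have [|n [s [n_large s_cover]]] :=
    @mean_filter_finite_sets R k X VQ lambda M M_mean.
  by exists phi0.
have FF : Filter (mean_filter M) by exact: mean_filter_filter.
have /choice[T TP] (g : bidual X) :
    exists T, almost_linear_retraction (s g) (n g).+1%:R^-1 T.
  by apply: exists_almost_linear_retraction; rewrite invr_gt0.
(* The default value 0, taken for almost no [g], keeps [F] bounded. *)
have /choice[F FE] (phi : bidual X) :
    exists F : linfty (Algebra.to_multiplicative (bidual X)) X,
    forall g, F g = if phi \in s g then T g phi else 0.
  apply: (@exists_linfty _ _ _ _ _ (`|phi| + 1)) => g.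
  case: ifP => [sg|_]; last by rewrite normr0 addr_ge0.
  have [Tle _ _] := TP g; rewrite (le_trans (Tle _ sg))// lerD2l.
  by rewrite invf_le1// ler1n.
have n_inv N g : (N <= n g)%N -> (n g).+1%:R^-1 <= N.+1%:R^-1 :> K.
  by move=> Ng; rewrite lef_pV2 ?posrE// ler_nat.
have Mnorm phi : `|M (F phi)| <= lambda * `|phi|.
  apply: (norm_mean_le M_mean) => // N.
  apply: (@filterS2 _ _ FF _ _ _ _ (n_large N) (s_cover phi)) => g /= Ng sg.
  have [Tle _ _] := TP g; rewrite FE sg (le_trans (Tle _ sg))// lerD2l.
  exact: n_inv.
have M0 : M (F 0) = 0.
  by apply/eqP; rewrite -normr_le0 (le_trans (Mnorm 0))// normr0 mulr0.
exists (fun phi => M (F phi)); split=> // [a u v|x].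
  (* Retractions are almost linear only for nonzero [u]; the other case amounts to [M (F 0) = 0]. *)
  have [->|u0] := eqVneq u 0; first by rewrite scaler0 M0 scaler0 !add0r.
  apply/eqP; rewrite -subr_eq0 -normr_le0 -(linearP M) -linearB.
  rewrite -[leRHS](mulr0 lambda); apply: (norm_mean_le M_mean) => // N.
  apply: (@filterS2 _ _ FF _ _ _ _ (n_large N)
    (filterI (s_cover (a *: u + v)) (filterI (s_cover u) (s_cover v)))).
  move=> g /= Ng [sw [su sv]]; have [_ Tlin _] := TP g.
  rewrite add0r (le_trans _ (n_inv _ _ Ng))// (le_trans _ (Tlin a u v u0 su sv sw))//.
  by rewrite -[X in `|X|]/(F _ g - (a *: F u g + F v g)) !FE sw su sv.
apply/eqP; rewrite -subr_eq0 -normr_le0 -[X in _ - X]Mcst -linearB.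
rewrite -[leRHS](mulr0 lambda); apply: (norm_mean_le M_mean) => // N.
apply: (@filterS2 _ _ FF _ _ _ _ (n_large N) (s_cover (kappa x))) => g /= Ng sg.
have [_ _ Tkappa] := TP g; rewrite add0r (le_trans _ (n_inv _ _ Ng))//.
rewrite (le_trans _ (Tkappa _ sg))//.
by rewrite -[X in `|X|]/(F _ g - x) FE sg.
Qed.

End Complementation.

Theorem theoremA (R : realType) (k : scalar_kind)
    (X : completeNormedModType (scalars R k)) (lambda : scalars R k)
    (hlambda : 1 <= lambda) :
  [<-> complemented_in_bidual X lambda;
       forall S : semigroupType,
         amenable R k S -> has_invariant_mean S X lambda;
       forall G : groupType, free_abelian_group_of_rank (bidual X) G ->
         has_invariant_mean G X lambda;
       has_invariant_mean (Algebra.to_multiplicative (bidual X)) X lambda].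
Proof.
tfae.
- by move=> Xc S; exact: complemented_has_invariant_mean.
- by move=> meanS G Gfree; apply: meanS; exact: free_abelian_amenable Gfree.
- exact: free_abelian_mean_zmodule.
- by apply: invariant_mean_complemented; exact: le_trans hlambda.
Qed.
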